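(* Let $b,c\in\mathbb{Z}$ and $d=b^2-4c$, and for $n\in\mathbb{N}$ let $T_n(b,c)=\sum_{k=0}^{\lfloor n/2\rfloor}\binom n{2k}\binom{2k}k b^{n-2k}c^k$. (i) For every positive integer $n$, $$\sum_{k=0}^{n-1}(2k+1)T_k(b,c)^2(-d)^{n-1-k}\equiv0\pmod n,$$ and moreover $$b\sum_{k=0}^{n-1}(2k+1)T_k(b,c)^2(-d)^{n-1-k}=nT_n(b,c)T_{n-1}(b,c).$$ (ii) For every positive integer $n$, $$\frac1{n^2}\sum_{k=0}^{n-1}(2k+1)T_k(b,c)^2d^{n-1-k}=\sum_{k=0}^{n-1}\binom{n-1}k\binom{n+k}k C_kc^kd^{n-1-k}\in\mathbb{Z},$$ where $C_k=\frac1{k+1}\binom{2k}k$. If $c\ne0$ and $p$ is an odd prime not dividing $d$, then $$\frac1{p^2}\sum_{k=0}^{p-1}(2k+1)\frac{T_k(b,c)^2}{d^k}\equiv1+\frac{b^2}{c}\cdot\frac{\left(\frac dp\right)-1}{2}\pmod p.$$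
   Context: $T_n(b,c)$ is the coefficient of $x^n$ in $(x^2+bx+c)^n$; $C_k$ is the $k$th Catalan number. $\left(\frac{\cdot}{p}\right)$ denotes the Legendre symbol. Congruences between rationals are understood in the ring of rationals with denominator prime to $p$. *)

(* Defs.v *)
From HB Require Import structures.
From mathcomp Require Import all_boot all_order all_algebra.

Set Implicit Arguments.
Unset Strict Implicit.
Unset Printing Implicit Defensive.

Import Order.TTheory GRing.Theory Num.Theory.
Local Open Scope ring_scope.

Definition trinom (b c : int) (n : nat) : int :=
  \sum_(0 <= k < (n./2).+1)
    ('C(n, k.*2) * 'C(k.*2, k))%:R * b ^+ (n - k.*2) * c ^+ k.

(* Rational-valued, so that integrality of expressions involving it is not
   built in by a truncated division. *)
Definition catalan (k : nat) : rat := 'C(k.*2, k)%:R / k.+1%:R.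

(* Intended for p an odd prime. *)
Definition legendre (a : int) (p : nat) : int :=
  if (p %| a)%Z then 0
  else if [exists x : 'I_p, ((x : nat)%:Z ^+ 2 == a %[mod p])%Z] then 1
  else -1.

(* Membership in the localization of Z at p; denq is the denominator in lowest
   terms. *)
Definition p_integral (p : nat) (x : rat) : bool := coprimez p (denq x).

(* Congruence modulo p in that ring, which includes that both sides belong to
   it. *)
Definition eqmod_rat (p : nat) (x y : rat) : Prop :=
  [/\ p_integral p x, p_integral p y
    & exists2 z : rat, p_integral p z & x - y = p%:R * z].

(* Main.v *)
(* The recurrence (n+2) T_{n+2} = (2n+3) b T_{n+1} - (n+1) d T_n yields, by a
   joint induction using b^2 = d + 4c, the Clausen-type expansions
     T_n^2       = sum_k C(n,k) C(n+k,k)   C(2k,k) c^k d^(n-k),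
     T_{n+1} T_n = b sum_k C(n,k) C(n+1+k,k) C(2k,k) c^k d^(n-k).
   Both weighted sums of squares then telescope against these coefficients:
   with -d the sum over k <= n is n+1 times the second expansion divided by b,
   with d it is (n+1)^2 times the same sum with C(2k,k) replaced by the Catalan
   number C_k.
   Modulo p = 2m+1, C(p-1,k) = (-1)^k, C(p+k,k) = 1, and
   C_k = 2 C(m+1,k+1) (-4)^k for k < p-1 while C_{p-1} = -1, so the binomial
   theorem sums the Catalan expression and Euler's criterion evaluates
   d^m. *)

Require Import Defs.
From HB Require Import structures.
From mathcomp Require Import all_boot all_order all_algebra all_field.
From mathcomp Require Import ring zify.

Set Implicit Arguments.
Unset Strict Implicit.
Unset Printing Implicit Defensive.

Import Order.TTheory GRing.Theory Num.Theory.
Local Open Scope ring_scope.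

(** * Division-free ratios of neighbouring binomial coefficients *)

Section BinomialRatios.

Variable R : comNzRingType.
Implicit Types n k : nat.

Lemma natr_bin_diag n k :
  k.+1%:R * 'C(n.+1, k.+1)%:R = n.+1%:R * 'C(n, k)%:R :> R.
Proof. by rewrite -!natrM -mul_bin_diag. Qed.

(** Subtracting in the ring rather than in [nat] removes any side condition: for k > n both
    binomials vanish. *)
Lemma natr_bin_left n k :
  k.+1%:R * 'C(n, k.+1)%:R = (n%:R - k%:R) * 'C(n, k)%:R :> R.
Proof.
have [lekn|ltnk] := leqP k n; first by rewrite -natrB // -!natrM mul_bin_left.
by rewrite !bin_small ?mulr0 // ltnS ltnW.
Qed.

Lemma natr_bin_down n k :
  (n.+1%:R - k%:R) * 'C(n.+1, k)%:R = n.+1%:R * 'C(n, k)%:R :> R.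
Proof.
have [lekn|ltnk] := leqP k n.+1.
  by rewrite -natrB // -!natrM -mul_bin_down.
by rewrite !bin_small ?mulr0 // ltnW.
Qed.

Lemma natr_central_bin k :
  k.+1%:R * 'C(k.+1.*2, k.+1)%:R = 2 * (2 * k%:R + 1) * 'C(k.*2, k)%:R :> R.
Proof.
have h : (k.+1 * 'C(k.+1.*2, k.+1) = 2 * (2 * k + 1) * 'C(k.*2, k))%N.
  (* The spare factor k+1 lets both ratios pass through C(2k+1, k) without division. *)
  apply/eqP; rewrite -(eqn_pmul2l (ltn0Sn k)); apply/eqP.
  have e1 := mul_bin_diag k.+1.*2 k.
  have e2 := mul_bin_down k.*2.+1 k.
  rewrite doubleS /= in e1 e2 *.
  have e3 : (k.*2.+1 - k = k.+1)%N by lia.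
  rewrite e3 in e2; nia.
by rewrite -natrM h !natrM natrD natrM.
Qed.

End BinomialRatios.

(** * Products of binomials and their ratios in n and k *)

Definition tcoef (n k : nat) : int := 'C(n, k)%:R * 'C(n + k, k)%:R.
(* Shifted index: this is C(N-1, k) C(N+k, k) for N = n + 1. *)
Definition scoef (n k : nat) : int := 'C(n, k)%:R * 'C(n.+1 + k, k)%:R.

(** With [scoef_tcoefS] this makes [scoef n] the bridge between [tcoef n] and [tcoef n.+1]. *)
Lemma scoef_tcoef n k : n.+1%:R * scoef n k = (n%:R + k%:R + 1) * tcoef n k.
Proof.
have := natr_bin_down int (n + k) k.
rewrite /scoef /tcoef addSn => e.
have {}e : n.+1%:R * 'C((n + k).+1, k)%:R = (n + k).+1%:R * 'C(n + k, k)%:R :> int.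
  by rewrite -e; congr (_ * _); rewrite -addSn natrD addrK.
by rewrite mulrCA e -natr1 natrD; ring.
Qed.

Lemma scoef_tcoefS n k :
  n.+1%:R * scoef n k = (n%:R + 1 - k%:R) * tcoef n.+1 k.
Proof.
rewrite /scoef /tcoef mulrA -natr_bin_down -natr1; ring.
Qed.

Lemma tcoef_rec n k :
  k.+1%:R ^+ 2 * tcoef n k.+1 = (n%:R - k%:R) * (n%:R + k%:R + 1) * tcoef n k.
Proof.
rewrite /tcoef addnS.
have e1 := natr_bin_left int n k; have e2 := natr_bin_diag int (n + k) k.
transitivity ((k.+1%:R * 'C(n, k.+1)%:R) * (k.+1%:R * 'C((n + k).+1, k.+1)%:R) : int).
  by ring.
by rewrite e1 e2 -natr1 natrD; ring.
Qed.

(** A diagonal step: [tcoef_rec] lowers k+1 to k at level n+1, then the bridge through [scoef n k]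
    lowers n+1 to n. *)
Lemma tcoefS_rec n k :
  k.+1%:R ^+ 2 * tcoef n.+1 k.+1 =
  (n%:R + k%:R + 1) * (n%:R + k%:R + 2) * tcoef n k.
Proof.
have e := tcoef_rec n.+1 k.
have e1 := scoef_tcoef n k; have e2 := scoef_tcoefS n k.
rewrite e -natr1.
transitivity ((n%:R + k%:R + 2) * ((n%:R + 1 - k%:R) * tcoef n.+1 k)); first by ring.
by rewrite -e2 e1; ring.
Qed.

Lemma tcoef_small n k : (n < k)%N -> tcoef n k = 0.
Proof. by move=> ltnk; rewrite /tcoef bin_small ?mul0r. Qed.

Lemma scoef_small n k : (n < k)%N -> scoef n k = 0.
Proof. by move=> ltnk; rewrite /scoef bin_small ?mul0r. Qed.

(** * Homogeneous sums in c and d, and multiplication by c or d on coefficients *)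

Definition shift (R : nmodType) (f : nat -> R) (k : nat) : R :=
  if k is k'.+1 then f k' else 0.

Section HomogeneousSum.

Variables (R : comNzRingType) (c d : R).
Implicit Types f g : nat -> R.

(** Homogeneity of degree n lets recurrences between sums be checked coefficient by coefficient,
    powers of d only adjusting the degree. *)
Definition hsum (n : nat) f : R := \sum_(0 <= k < n.+1) f k * c ^+ k * d ^+ (n - k).

Lemma eq_hsum n f g : (forall k, (k <= n)%N -> f k = g k) -> hsum n f = hsum n g.
Proof. by move=> fg; apply: eq_big_nat => k; rewrite ltnS => /fg ->. Qed.

Lemma hsumD n f g : hsum n (fun k => f k + g k) = hsum n f + hsum n g.
Proof. by rewrite -big_split; apply: eq_bigr => k _; rewrite !mulrDl. Qed.

Lemma hsumZ n a f : hsum n (fun k => a * f k) = a * hsum n f.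
Proof. by rewrite mulr_sumr; apply: eq_bigr => k _; rewrite !mulrA. Qed.

Lemma hsum_mul_d n f : f n.+1 = 0 -> d * hsum n f = hsum n.+1 f.
Proof.
move=> fn0; rewrite /hsum [in RHS]big_nat_recr //= fn0 !mul0r addr0 mulr_sumr.
by apply: eq_big_nat => k; rewrite ltnS => kn; rewrite subSn // exprS mulrCA.
Qed.

Lemma hsum_mul_c n f : c * hsum n f = hsum n.+1 (shift f).
Proof.
rewrite /hsum [in RHS]big_nat_recl //= !mul0r add0r mulr_sumr.
by apply: eq_bigr => k _; rewrite subSS exprS; ring.
Qed.

End HomogeneousSum.

Lemma intr_hsum (R : comNzRingType) (c d : int) n f :
  (hsum c d n f)%:~R = hsum (c%:~R : R) d%:~R n (fun k => (f k)%:~R).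
Proof.
by rewrite rmorph_sum; apply: eq_bigr => k _; rewrite !rmorphM !rmorphXn.
Qed.

(** * The three-term recurrence for T_n *)

Section Trinomial.

Variables b c : int.
Local Notation T := (trinom b c).

(** The bound [N] is independent of the degree [n], so that sums of different degrees can be added
    over one range. *)
Definition bsum (N n : nat) (f : nat -> int) : int :=
  \sum_(0 <= k < N) f k * b ^+ (n - k.*2) * c ^+ k.

Lemma bsumD N n f g : bsum N n (fun k => f k + g k) = bsum N n f + bsum N n g.
Proof. by rewrite -big_split; apply: eq_bigr => k _; rewrite !mulrDl. Qed.

Lemma bsumZ N n a f : bsum N n (fun k => a * f k) = a * bsum N n f.
Proof. by rewrite mulr_sumr; apply: eq_bigr => k _; rewrite !mulrA. Qed.

(** The hypothesis kills the terms whose truncated exponent [n - k.*2] would not grow with n. *)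
Lemma bsum_mul_b N n f : (forall k, (n < k.*2)%N -> f k = 0) ->
  b * bsum N n f = bsum N n.+1 f.
Proof.
move=> f0; rewrite mulr_sumr; apply: eq_bigr => k _.
have [le|/f0 ->] := leqP k.*2 n; last by rewrite !mul0r mulr0.
by rewrite subSn // exprS; ring.
Qed.

Lemma bsum_mul_c N n f : c * bsum N n f = bsum N.+1 n.+2 (shift f).
Proof.
rewrite /bsum [in RHS]big_nat_recl //= !mul0r add0r mulr_sumr.
by apply: eq_bigr => k _; rewrite doubleS !subSS exprS; ring.
Qed.

Lemma bsum_widen N M n f : (forall k, (n < k.*2)%N -> f k = 0) ->
  (n < N.*2)%N -> (N <= M)%N -> bsum M n f = bsum N n f.
Proof.
move=> f0 nN NM; rewrite /bsum (big_cat_nat _ (n := N)) //=.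
rewrite [X in _ + X]big1_seq ?addr0 // => k /andP[_].
rewrite mem_index_iota => /andP[Nk _].
by rewrite f0 ?mul0r // (leq_trans nN) // leq_double.
Qed.

Definition qcoef (n k : nat) : int := 'C(n, k.*2)%:R * 'C(k.*2, k)%:R.

Lemma qcoef_small n k : (n < k.*2)%N -> qcoef n k = 0.
Proof. by move=> h; rewrite /qcoef bin_small ?mul0r. Qed.

Lemma trinomE N n : (n < N.*2)%N -> T n = bsum N n (qcoef n).
Proof.
move=> nN; rewrite (@bsum_widen (n./2).+1) //.
- by apply: eq_bigr => k _; rewrite natrM.
- exact: qcoef_small.
- by rewrite doubleS; lia.
- by lia.
Qed.

Lemma qcoefS n k :
  (n%:R + 1) * qcoef n k = (n%:R + 1 - 2 * k%:R) * qcoef n.+1 k.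
Proof.
have e := natr_bin_down int n k.*2; rewrite -natr1 in e.
rewrite /qcoef mulrA -e -mul2n natrM; ring.
Qed.

Lemma qcoef_rec n k :
  k.+1%:R ^+ 2 * qcoef n k.+1 =
  (n%:R - 2 * k%:R) * (n%:R - 2 * k%:R - 1) * qcoef n k.
Proof.
rewrite /qcoef.
have e1 := natr_bin_left int n k.*2; have e2 := natr_bin_left int n k.*2.+1.
have e3 := natr_central_bin int k.
have ek : k.*2%:R = 2 * k%:R :> int by rewrite -mul2n natrM.
rewrite -doubleS in e2.
transitivity (k.+1%:R * 'C(n, k.+1.*2)%:R * (k.+1%:R * 'C(k.+1.*2, k.+1)%:R) : int).
  by ring.
rewrite e3.
transitivity (k.*2.+1%:R * (k.+1.*2%:R * 'C(n, k.+1.*2)%:R) * 'C(k.*2, k)%:R : int).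
  by rewrite doubleS -!natr1 ek; ring.
rewrite {1}doubleS e2 mulrA [X in X * _ = _]mulrC.
transitivity ((n%:R - k.*2.+1%:R) * (k.*2.+1%:R * 'C(n, k.*2.+1)%:R) * 'C(k.*2, k)%:R : int).
  by ring.
by rewrite e1 -natr1 ek; ring.
Qed.

(** The recurrence for T_n with d replaced by b^2 - 4c, read off coefficientwise; the shifted term
    comes from 4c. *)
Lemma qcoef_three_term n k :
  n.+2%:R * qcoef n.+2 k = (2 * n%:R + 3) * qcoef n.+1 k
    + (- n.+1%:R) * qcoef n k + 4 * n.+1%:R * shift (qcoef n) k.
Proof.
case: k => [|k] /=.
  by rewrite /qcoef /= double0 !bin0 -!natr1; ring.
have k0 : k.+1%:R ^+ 2 != 0 :> int by rewrite expf_neq0 // pnatr_eq0.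
have e0 := qcoef_rec n k; have e1 := qcoef_rec n.+1 k; have e2 := qcoef_rec n.+2 k.
have f1 := qcoefS n k; have f2 := qcoefS n.+1 k.
apply: (mulfI k0).
transitivity (n.+2%:R * (k.+1%:R ^+ 2 * qcoef n.+2 k.+1)); first by ring.
rewrite e2; symmetry.
transitivity ((2 * n%:R + 3) * (k.+1%:R ^+ 2 * qcoef n.+1 k.+1)
   - n.+1%:R * (k.+1%:R ^+ 2 * qcoef n k.+1)
   + 4 * k.+1%:R ^+ 2 * (n.+1%:R * qcoef n k)); first by ring.
rewrite e0 e1.
have en : n.+1%:R = n%:R + 1 :> int by rewrite -natr1.
have enn : n.+2%:R = n%:R + 2 :> int by rewrite -addn2 natrD.
have ek : k.+1%:R = k%:R + 1 :> int by rewrite -natr1.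
rewrite en enn ek in f1 f2 *.
set A := qcoef n k in f1 *; set B := qcoef n.+1 k in f1 f2 *; set C := qcoef _ k in f2 *.
(* Composing the steps n to n+1 to n+2 makes every term a multiple of [A]. *)
have g : (n%:R + 1) * (n%:R + 1 + 1) * A = (n%:R + 1 - 2 * k%:R) * (n%:R + 2 - 2 * k%:R) * C.
  rewrite mulrAC f1.
  transitivity ((n%:R + 1 - 2 * k%:R) * ((n%:R + 1 + 1) * B)); first by ring.
  by rewrite f2; ring.
transitivity ((n%:R + 1) * (n%:R + 1 + 1) * A * (n%:R + 1 + 1)); last by rewrite g; ring.
transitivity ((2 * n%:R + 3) * (n%:R - 2 * k%:R) * ((n%:R + 1 - 2 * k%:R) * B)
   + (4 * (k%:R + 1) ^+ 2 - (n%:R - 2 * k%:R) * (n%:R - 2 * k%:R - 1)) * ((n%:R + 1) * A)); first by ring.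
by rewrite -f1; ring.
Qed.

Lemma trinom_rec n :
  n.+2%:R * T n.+2 =
  (2 * n%:R + 3) * b * T n.+1 - n.+1%:R * (b ^+ 2 - 4 * c) * T n.
Proof.
(* The bound n+2 suffices for all three sums, even for the one that loses a term when c is factored
   out. *)
rewrite (@trinomE n.+2 n.+2); last by lia.
rewrite -bsumZ.
under [X in X = _]eq_bigr => k _ do rewrite qcoef_three_term.
rewrite -/(bsum _ _ _) !bsumD !bsumZ -bsum_mul_c.
have sm k : (n.+1 < k.*2)%N -> qcoef n k = 0 by move/ltnW/qcoef_small.
rewrite -(bsum_mul_b _ (@qcoef_small n.+1)) -(bsum_mul_b _ sm).
rewrite -(bsum_mul_b _ (@qcoef_small n)) -!trinomE; [|lia..].
by ring.
Qed.

End Trinomial.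

(** * Coefficients of T_n^2 ([xcoef]) and of T_{n+1} T_n / b ([zcoef]) *)

Definition xcoef (n k : nat) : int := tcoef n k * 'C(k.*2, k)%:R.
Definition zcoef (n k : nat) : int := scoef n k * 'C(k.*2, k)%:R.

Lemma xcoef_small n k : (n < k)%N -> xcoef n k = 0.
Proof. by move=> h; rewrite /xcoef tcoef_small ?mul0r. Qed.

Lemma zcoef_small n k : (n < k)%N -> zcoef n k = 0.
Proof. by move=> h; rewrite /zcoef scoef_small ?mul0r. Qed.

(** Coefficient form of the three-term recurrence multiplied by T_{n+1} / b. *)
Lemma zcoef_rec n k :
  n.+2%:R * zcoef n.+1 k = (2 * n%:R + 3) * xcoef n.+1 k + (- n.+1%:R) * zcoef n k.
Proof.
rewrite /zcoef /xcoef.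
transitivity (n.+2%:R * scoef n.+1 k * 'C(k.*2, k)%:R); first by ring.
symmetry; transitivity ((2 * n%:R + 3) * tcoef n.+1 k * 'C(k.*2, k)%:R
  - n.+1%:R * scoef n k * 'C(k.*2, k)%:R); first by ring.
rewrite (scoef_tcoef n.+1) (scoef_tcoefS n) -(natr1 n); ring.
Qed.

(** Coefficient form of the squared three-term recurrence; each factor b^2 = d + 4c yields a term
    plus four times its shift. *)
Lemma xcoef_rec n k :
  n.+2%:R ^+ 2 * xcoef n.+2 k =
    (2 * n%:R + 3) ^+ 2 * (xcoef n.+1 k + 4 * shift (xcoef n.+1) k)
    + (- (2 * (2 * n%:R + 3) * n.+1%:R)) * (zcoef n k + 4 * shift (zcoef n) k)
    + n.+1%:R ^+ 2 * xcoef n k.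
Proof.
have en : n.+1%:R = n%:R + 1 :> int by rewrite -natr1.
have enn : n.+2%:R = n%:R + 2 :> int by rewrite -addn2 natrD.
case: k => [|k] /=.
  rewrite /xcoef /zcoef /tcoef /scoef /= double0 !bin0 en enn; ring.
(* Two factors k+1 lower the index of [tcoef] and one that of the central binomial; all terms become
   multiples of [tcoef n.+1 k * 'C(k.*2, k)]. *)
have k0 : k.+1%:R ^+ 3 != 0 :> int by rewrite expf_neq0 // pnatr_eq0.
apply: (mulfI k0).
have ek : k.+1%:R = k%:R + 1 :> int by rewrite -natr1.
have hc := natr_central_bin int k.
have t2 := tcoefS_rec n.+1 k; have t1 := tcoef_rec n.+1 k; have t0 := tcoef_rec n k.
have s0 := scoef_tcoefS n k; have s0' := scoef_tcoef n k.
have s1 := scoef_tcoef n k.+1.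
rewrite /xcoef /zcoef.
transitivity (n.+2%:R ^+ 2 * (k.+1%:R ^+ 2 * tcoef n.+2 k.+1)
              * (k.+1%:R * 'C(k.+1.*2, k.+1)%:R)); first by ring.
symmetry.
transitivity ((2 * n%:R + 3) ^+ 2 *
   ((k.+1%:R ^+ 2 * tcoef n.+1 k.+1) * (k.+1%:R * 'C(k.+1.*2, k.+1)%:R)
    + 4 * k.+1%:R ^+ 3 * tcoef n.+1 k * 'C(k.*2, k)%:R)
  - 2 * (2 * n%:R + 3) *
    (k.+1%:R ^+ 2 * (n.+1%:R * scoef n k.+1) * (k.+1%:R * 'C(k.+1.*2, k.+1)%:R)
     + 4 * k.+1%:R ^+ 3 * (n.+1%:R * scoef n k) * 'C(k.*2, k)%:R)
  + n.+1%:R ^+ 2 * (k.+1%:R ^+ 2 * tcoef n k.+1) * (k.+1%:R * 'C(k.+1.*2, k.+1)%:R)).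
  by ring.
have t0' : k.+1%:R ^+ 2 * tcoef n k.+1
    = (n%:R - k%:R) * (n%:R + 1 - k%:R) * tcoef n.+1 k.
  by rewrite t0 -mulrA -s0' s0; ring.
have s1' : k.+1%:R ^+ 2 * (n.+1%:R * scoef n k.+1)
    = (n%:R + k%:R + 2) * ((n%:R - k%:R) * (n%:R + 1 - k%:R) * tcoef n.+1 k).
  by rewrite s1 -t0' ek; ring.
rewrite hc t2 t1 t0' s1' s0 enn en ek; ring.
Qed.

(** * Integer Catalan numbers and the coefficients of the Catalan sum *)

Definition catz (k : nat) : int := 'C(k.*2, k)%:R - 'C(k.*2, k.+1)%:R.

(** The difference form is integral by construction, and (k+1) C(2k, k+1) = k C(2k, k) identifies it
    with the Catalan number. *)
Lemma catzE k : k.+1%:R * catz k = 'C(k.*2, k)%:R.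
Proof.
have := natr_bin_left int k.*2 k.
rewrite /catz mulrBr => ->; rewrite -natr1 -mul2n natrM; ring.
Qed.

Lemma catz_rec k : k.+2%:R * catz k.+1 = 2 * (2 * k%:R + 1) * catz k.
Proof.
have k0 : k.+1%:R != 0 :> int by rewrite pnatr_eq0.
apply: (mulfI k0); rewrite catzE natr_central_bin -(catzE k); ring.
Qed.

Definition wcoef (n k : nat) : int := scoef n k * catz k.

Lemma wcoef_small n k : (n < k)%N -> wcoef n k = 0.
Proof. by move=> h; rewrite /wcoef scoef_small ?mul0r. Qed.

(** Telescoping rests on (n+2)(n+k+2) - (n+1)(n+1-k) = (2n+3)(k+1), whose factor k+1 turns C_k into
    C(2k, k). *)
Lemma wcoef_rec n k :
  n.+2%:R ^+ 2 * wcoef n.+1 k =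
  n.+1%:R ^+ 2 * wcoef n k + (2 * n%:R + 3) * xcoef n.+1 k.
Proof.
rewrite /wcoef /xcoef -catzE.
transitivity (n.+2%:R * (n.+2%:R * scoef n.+1 k) * catz k); first by ring.
rewrite (scoef_tcoef n.+1).
symmetry; transitivity (n.+1%:R * (n.+1%:R * scoef n k) * catz k
   + (2 * n%:R + 3) * (tcoef n.+1 k * (k.+1%:R * catz k))); first by ring.
rewrite (scoef_tcoefS n).
have -> : n.+1%:R = n%:R + 1 :> int by rewrite -natr1.
have -> : n.+2%:R = n%:R + 2 :> int by rewrite -addn2 natrD.
have -> : k.+1%:R = k%:R + 1 :> int by rewrite -natr1.
ring.
Qed.

Lemma sum_expr_recr (f : nat -> int) (e : int) n :
  \sum_(0 <= k < n.+2) f k * e ^+ (n.+1 - k) =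
  e * (\sum_(0 <= k < n.+1) f k * e ^+ (n - k)) + f n.+1.
Proof.
rewrite big_nat_recr //= subnn expr0 mulr1 mulr_sumr; congr (_ + _).
by apply: eq_big_nat => k; rewrite ltnS => kn; rewrite subSn // exprS mulrCA.
Qed.

(** * Expansions of T_n^2 and T_{n+1} T_n, and the two weighted sums *)

Section Square.

Variables b c d : int.
Hypothesis hd : d = b ^+ 2 - 4 * c.
Local Notation T := (trinom b c).
Local Notation H := (hsum c d).

Lemma hsum_zcoef_rec n :
  n.+2%:R * H n.+1 (zcoef n.+1) =
  (2 * n%:R + 3) * H n.+1 (xcoef n.+1) - n.+1%:R * d * H n (zcoef n).
Proof.
rewrite -hsumZ (eq_hsum _ _ (fun k _ => zcoef_rec n k)) hsumD !hsumZ.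
rewrite -(hsum_mul_d _ _ (zcoef_small (ltnSn n))); ring.
Qed.

Lemma hsum_xcoef_rec n :
  n.+2%:R ^+ 2 * H n.+2 (xcoef n.+2) =
    (2 * n%:R + 3) ^+ 2 * (b ^+ 2 * H n.+1 (xcoef n.+1))
    - 2 * (2 * n%:R + 3) * n.+1%:R * d * (b ^+ 2 * H n (zcoef n))
    + n.+1%:R ^+ 2 * d ^+ 2 * H n (xcoef n).
Proof.
rewrite -hsumZ (eq_hsum _ _ (fun k _ => xcoef_rec n k)) !hsumD !hsumZ !hsumD !hsumZ.
rewrite -!hsum_mul_c.
rewrite -(hsum_mul_d _ _ (xcoef_small (ltnSn n.+1))).
rewrite -(hsum_mul_d _ _ (zcoef_small (ltnW (ltnSn n.+1)))).
rewrite -!(hsum_mul_d _ _ (zcoef_small (ltnSn n))).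
rewrite -(hsum_mul_d _ _ (xcoef_small (ltnW (ltnSn n.+1)))).
rewrite -(hsum_mul_d _ _ (xcoef_small (ltnSn n))).
have -> : b ^+ 2 = d + 4 * c by rewrite hd; ring.
ring.
Qed.

Lemma trinom0 : T 0 = 1.
Proof. by rewrite /trinom big_nat1 /= !expr0 !mulr1. Qed.

Lemma trinom1 : T 1 = b.
Proof. by rewrite /trinom big_nat1 /= !expr0 expr1 mul1r mulr1. Qed.

(** Squaring the second-order recurrence needs two consecutive squares and the cross term T_{n+1}
    T_n, so the three claims go through one induction. *)
Lemma trinom_sqr_mul n :
  [/\ T n ^+ 2 = H n (xcoef n), T n.+1 ^+ 2 = H n.+1 (xcoef n.+1)
    & T n.+1 * T n = b * H n (zcoef n)].
Proof.
elim: n => [|n [x0 x1 z0]].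
  rewrite trinom0 trinom1 /hsum /xcoef /zcoef /tcoef /scoef !big_nat1.
  rewrite big_nat_recr //= big_nat1 /= !bin0 !binn !bin1 /= hd; split; ring.
have n2 : n.+2%:R != 0 :> int by rewrite pnatr_eq0.
have r := trinom_rec b c n; rewrite -hd in r.
split=> //.
  apply: (mulfI (expf_neq0 2 n2)); rewrite hsum_xcoef_rec -x0 -x1 -exprMn r.
  transitivity ((2 * n%:R + 3) ^+ 2 * (b ^+ 2 * T n.+1 ^+ 2)
    - 2 * (2 * n%:R + 3) * n.+1%:R * d * b * (T n.+1 * T n)
    + n.+1%:R ^+ 2 * d ^+ 2 * T n ^+ 2); first by ring.
  by rewrite z0; ring.
apply: (mulfI n2); rewrite [RHS]mulrCA hsum_zcoef_rec -x1 mulrA r.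
transitivity ((2 * n%:R + 3) * b * T n.+1 ^+ 2 - n.+1%:R * d * (T n.+1 * T n)).
  by ring.
by rewrite z0; ring.
Qed.

Lemma trinom_sqr n : T n ^+ 2 = H n (xcoef n).
Proof. by case: (trinom_sqr_mul n). Qed.

Lemma trinom_mulS n : T n.+1 * T n = b * H n (zcoef n).
Proof. by case: (trinom_sqr_mul n). Qed.

(** The Horner step with ratio -d is exactly [hsum_zcoef_rec] once T_{n+1}^2 is expanded. *)
Lemma sum_trinom_sqr_opp n :
  \sum_(0 <= k < n.+1) (2 * k + 1)%:R * T k ^+ 2 * (- d) ^+ (n - k) =
  n.+1%:R * H n (zcoef n).
Proof.
elim: n => [|n IH].
  by rewrite /hsum !big_nat1 trinom0 /zcoef /scoef /= !bin0; ring.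
rewrite (sum_expr_recr (fun k => (2 * k + 1)%:R * T k ^+ 2)) IH hsum_zcoef_rec trinom_sqr.
have -> : (2 * n.+1 + 1)%:R = 2 * n%:R + 3 :> int.
  by rewrite -natrM -natrD; congr _%:R; lia.
ring.
Qed.

Lemma sum_trinom_sqr n :
  \sum_(0 <= k < n.+1) (2 * k + 1)%:R * T k ^+ 2 * d ^+ (n - k) =
  n.+1%:R ^+ 2 * H n (wcoef n).
Proof.
elim: n => [|n IH].
  by rewrite /hsum !big_nat1 trinom0 /wcoef /scoef /catz /= !bin0 bin0n /= subr0; ring.
rewrite (sum_expr_recr (fun k => (2 * k + 1)%:R * T k ^+ 2)) IH.
rewrite -[RHS]hsumZ (eq_hsum _ _ (fun k _ => wcoef_rec n k)) hsumD !hsumZ.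
rewrite -(hsum_mul_d _ _ (wcoef_small (ltnSn n))) trinom_sqr.
have -> : (2 * n.+1 + 1)%:R = 2 * n%:R + 3 :> int.
  by rewrite -natrM -natrD; congr _%:R; lia.
ring.
Qed.

End Square.

(** * Euler's criterion and binomial and Catalan values modulo p = 2m + 1 *)

Section ModP.

Variables (p : nat) (p_pr : prime p) (p_odd : odd p).
Local Notation F := 'F_p.
Local Notation m := p./2.

Let p_gt0 : (0 < p)%N := prime_gt0 p_pr.

Let p_half : p = m.*2.+1.
Proof. by rewrite -[LHS]odd_double_half p_odd. Qed.

Lemma Fp_nat_eq0 n : (n%:R == 0 :> F) = (p %| n)%N.
Proof. by rewrite (dvdn_pcharf (pchar_Fp p_pr)). Qed.

Lemma Fp_int_eq0 (a : int) : (a%:~R == 0 :> F) = (p %| a)%Z.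
Proof. by rewrite (dvdz_pcharf (pchar_Fp p_pr)). Qed.

Lemma Fp_nat_neq0 n : (0 < n < p)%N -> n%:R != 0 :> F.
Proof. by case/andP=> n0 np; rewrite Fp_nat_eq0 gtnNdvd. Qed.

Lemma Fp_expp (x : F) : x ^+ p = x.
Proof. by rewrite -{2}(expf_card x) card_Fp. Qed.

Lemma Fp_fermat (x : F) : x != 0 -> x ^+ p.-1 = 1.
Proof.
move=> x0; apply: (mulfI x0); rewrite mulr1 -exprS prednK //; exact: Fp_expp.
Qed.

Lemma Fp_half_exp (x : F) : x != 0 -> (x ^+ m) ^+ 2 = 1.
Proof. by move=> x0; rewrite -exprM muln2 -(Fp_fermat x0); congr (_ ^+ _); move: p_half; lia. Qed.

(* X^m - 1 already has the m distinct roots 1^2, ..., m^2, hence no other. *)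
Lemma Fp_sqr_of_half_exp (x : F) : x ^+ m = 1 ->
  exists2 k : nat, (k < p)%N & k%:R ^+ 2 = x.
Proof.
move=> xm; have m_gt0 : (0 < m)%N.
  by have := prime_gt1 p_pr; move: p_half; lia.
pose s := [seq (k%:R : F) ^+ 2 | k <- iota 1 m].
have [/mapP[k]|xs] := boolP (x \in s).
  rewrite mem_iota => kr ->; exists k => //.
  by move: p_half; lia.
have sz : size ('X^m - 1 : {poly F}) = m.+1 by rewrite size_XnsubC.
have nz : 'X^m - 1 != 0 :> {poly F} by rewrite -size_poly_eq0 sz.
suff : (size (x :: s) < m.+1)%N by rewrite /= size_map size_iota ltnn.
rewrite -sz; apply: max_poly_roots => //=.
  rewrite rootE !hornerE xm subrr eqxx /=.
  apply/allP=> y /mapP[k]; rewrite mem_iota => kr ->.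
  rewrite rootE !hornerE exprAC Fp_half_exp ?subrr //.
  by apply: Fp_nat_neq0; move: p_half; lia.
rewrite xs map_inj_in_uniq ?iota_uniq // => i j.
rewrite !mem_iota => ir jr /eqP; rewrite eqf_sqr => /orP[] /eqP.
  wlog le_ij : i j ir jr / (i <= j)%N.
    move=> W e; case/orP: (leq_total i j) => h; first exact: W.
    by apply/esym/W.
  move/esym/eqP; rewrite -subr_eq0 -natrB // Fp_nat_eq0 => dv.
  have [//|lt] : i = j \/ (0 < j - i < p)%N by move: p_half; lia.
  by case/andP: lt => a b; rewrite gtnNdvd in dv.
(* The case i = -j is impossible, since 0 < i + j <= 2m < p. *)
move/eqP; rewrite -subr_eq0 opprK -natrD => e0.
suff : (i + j)%:R != 0 :> F by rewrite e0.
by apply: Fp_nat_neq0; move: p_half; lia.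
Qed.

(** Euler's criterion: a^m squares to 1, hence is 1 or -1, and the value 1 forces a square root. *)
Lemma legendre_euler (a : int) : ~~ (p %| a)%Z ->
  (legendre a p)%:~R = a%:~R ^+ m :> F.
Proof.
move=> pa; rewrite /legendre (negPf pa).
have a0 : a%:~R != 0 :> F by rewrite Fp_int_eq0.
have sq k : ((k%:Z ^+ 2 == a %[mod p])%Z) = (k%:R ^+ 2 == a%:~R :> F).
  by rewrite eqz_mod_dvd -Fp_int_eq0 rmorphB rmorphXn /= subr_eq0.
case: ifP => [/existsP[k]|/negbT/existsPn nex].
  rewrite sq => /eqP ek; rewrite -ek exprAC Fp_half_exp //.
  by apply: contraNneq a0 => k0; rewrite -ek k0 expr0n.
have := Fp_half_exp a0; move/eqP; rewrite sqrf_eq1 => /orP[] /eqP; last by move->.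
by case/Fp_sqr_of_half_exp=> k kp /eqP; rewrite -sq => h; have := nex (Ordinal kp); rewrite h.
Qed.

(** By Pascal's rule consecutive entries of row p-1 add up to C(p, k+1), which p divides. *)
Lemma Fp_bin_pred k : (k < p)%N -> 'C(p.-1, k)%:R = (-1) ^+ k :> F.
Proof.
elim: k => [|k IH] kp; first by rewrite bin0.
have := dvdn_pcharf (pchar_Fp p_pr) 'C(p, k.+1).
rewrite prime_dvd_bin // => /esym/eqP.
have -> : 'C(p, k.+1) = ('C(p.-1, k.+1) + 'C(p.-1, k))%N.
  by rewrite -binS prednK.
rewrite natrD IH ?(ltnW kp) // => /eqP.
by rewrite addr_eq0 => /eqP ->; rewrite exprS mulN1r.
Qed.

(** In Vandermonde's sum only the term with C(p, 0) survives modulo p. *)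
Lemma Fp_bin_add k : (k < p)%N -> 'C(p + k, k)%:R = 1 :> F.
Proof.
move=> kp; rewrite -(binomial.Vandermonde p k k) natr_sum big_ord_recl /=.
rewrite bin0 subn0 binn big1 ?addr0 // => i _.
rewrite natrM; apply/eqP; rewrite mulf_eq0 Fp_nat_eq0 prime_dvd_bin //=.
by case: i => i /=; rewrite /bump; lia.
Qed.

Lemma Fp_two_half : 2 * m%:R + 1 = 0 :> F.
Proof. by rewrite -natrM natr1 mul2n -p_half (eqP (_ : p%:R == 0)) ?Fp_nat_eq0. Qed.

(** Since 2m = -1, the Catalan ratio 2(2k+1)/(k+2) becomes -4(m-k)/(k+2), that of the right side;
    the bound on k keeps the denominators invertible. *)
Lemma Fp_catz k : (k < p.-1)%N ->
  (catz k)%:~R = 2 * 'C(m.+1, k.+1)%:R * (-4) ^+ k :> F.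
Proof.
elim: k => [|k IH] kp.
  rewrite /catz /= bin0 bin0n subr0 bin1 mulr1.
  have -> : m.+1%:R = m%:R + 1 :> F by rewrite -natr1.
  by rewrite -[LHS]add0r -Fp_two_half; ring.
have k2 : k.+2%:R != 0 :> F by apply: Fp_nat_neq0; lia.
apply: (mulfI k2).
have /(congr1 (fun x : int => x%:~R : F)) := catz_rec k.
have ek : (2 * k%:R + 1 : int)%:~R = 2 * k%:R + 1 :> F.
  by rewrite intrD intrM !rmorph_nat.
rewrite /= !intrM !rmorph_nat ek => ->; rewrite IH; last by lia.
have e := natr_bin_left F m.+1 k.+1.
transitivity (2 * (k.+2%:R * 'C(m.+1, k.+2)%:R) * (-4) ^+ k.+1 : F); last by ring.
rewrite e.
have h : 2 * k%:R + 1 = - 2 * (m.+1%:R - k.+1%:R) :> F.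
  rewrite -!natr1; apply/eqP; rewrite -subr_eq0; apply/eqP.
  by rewrite -[RHS]Fp_two_half; ring.
by rewrite h exprS; ring.
Qed.

(** Here C(2p-2, p-1) is p times a Catalan number, hence 0, while C(2p-2, p) = C(p+(p-2), p-2) is
    1. *)
Lemma Fp_catz_pred : (catz p.-1)%:~R = -1 :> F.
Proof.
have p2 := prime_gt1 p_pr.
have p3 : (2 < p)%N by move: p_half; lia.
have e : (p.-1.*2 = p + p.-2)%N by lia.
rewrite /catz prednK // rmorphB /= !rmorph_nat.
have -> : 'C(p.-1.*2, p) = 'C(p + p.-2, p.-2) by rewrite e -bin_sub ?addKn // leq_addr.
rewrite Fp_bin_add; last by lia.
suff /eqP -> : 'C(p.-1.*2, p.-1)%:R == 0 :> F by rewrite sub0r.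
have : p%:R * catz p.-1 = 'C(p.-1.*2, p.-1)%:R by rewrite -catzE prednK.
move/(congr1 (fun x : int => x%:~R : F)); rewrite /= intrM !rmorph_nat => <-.
by rewrite (eqP (_ : p%:R == 0 :> F)) ?mul0r // Fp_nat_eq0.
Qed.

Lemma Fp_scoef k : (k < p)%N -> (scoef p.-1 k)%:~R = (-1) ^+ k :> F.
Proof.
move=> kp; rewrite /scoef prednK // rmorphM /= !rmorph_nat Fp_bin_pred //.
by rewrite Fp_bin_add // mulr1.
Qed.

Lemma Fp_wcoef k : (k < p)%N ->
  (wcoef p.-1 k)%:~R = (-1) ^+ k * (catz k)%:~R :> F.
Proof. by move=> kp; rewrite /wcoef intrM Fp_scoef. Qed.

Variables (b c d : int).
Hypotheses (hd : d = b ^+ 2 - 4 * c) (pd : ~~ (p %| d)%Z).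

Local Notation W := (hsum c d p.-1 (wcoef p.-1)).

(** The case where 2c is not invertible is separate: only k = 0 survives, with value d^(p-1) = 1. *)
Lemma Fp_hsum_wcoef_dvd : (p %| c)%Z -> W%:~R = 1 :> F.
Proof.
move=> pc; have c0 : c%:~R = 0 :> F by apply/eqP; rewrite Fp_int_eq0.
have d0 : d%:~R != 0 :> F by rewrite Fp_int_eq0.
rewrite intr_hsum c0 /hsum big_nat_recl // big1_seq => [|k _].
  by rewrite addr0 subn0 Fp_fermat // Fp_wcoef // /catz bin0 bin0n !mulr1.
by rewrite expr0n mulr0 mul0r.
Qed.

(* Only the term k = p - 1 fails to follow the binomial pattern of Fp_catz. *)
Lemma Fp_hsum_wcoef : ~~ (p %| c)%Z ->
  2 * c%:~R * W%:~R = 2 * c%:~R + b%:~R ^+ 2 * ((legendre d p)%:~R - 1) :> F.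
Proof.
move=> pc; have c0 : c%:~R != 0 :> F by rewrite Fp_int_eq0.
have d0 : d%:~R != 0 :> F by rewrite Fp_int_eq0.
rewrite legendre_euler //.
set B := b%:~R : F; set C := c%:~R in c0 *; set D := d%:~R in d0 *.
have eD : D = B ^+ 2 - 4 * C.
  by rewrite /D hd rmorphB rmorphXn rmorphM /= rmorph_nat.
have p2 := prime_gt1 p_pr.
have em : p.-1 = (m + m)%N by move: p_half; lia.
have m0 : (0 < m)%N by lia.
have -> : W%:~R = -1 + 2 * \sum_(0 <= k < p.-1) 'C(m.+1, k.+1)%:R * (4 * C) ^+ k * D ^+ (p.-1 - k).
  rewrite intr_hsum /hsum big_nat_recr //= addrC; congr (_ + _).
    rewrite subnn expr0 mulr1 Fp_wcoef; last by lia.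
    by rewrite Fp_catz_pred !Fp_fermat ?oppr_eq0 ?oner_eq0 // mul1r mulr1.
  rewrite mulr_sumr; apply: eq_big_nat => k kp.
  rewrite Fp_wcoef; last by lia.
  rewrite Fp_catz //.
  have -> : (-4 : F) ^+ k = (-1) ^+ k * 4 ^+ k by rewrite -exprMn mulN1r.
  have sg : (-1) ^+ k * (-1) ^+ k = 1 :> F by rewrite -expr2 sqrr_sign.
  transitivity (((-1) ^+ k * (-1) ^+ k) * (2 * 'C(m.+1, k.+1)%:R * 4 ^+ k * C ^+ k * D ^+ (p.-1 - k))).
    by ring.
  by rewrite sg exprMn; ring.
(* The binomial expansion of (D + 4C)^(m+1) without its term D^(m+1); D^m factors out because p-1 =
   2m, and terms with k > m vanish. *)
have sumE : 4 * C * (\sum_(0 <= k < p.-1) 'C(m.+1, k.+1)%:R * (4 * C) ^+ k * D ^+ (p.-1 - k))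
   = D ^+ m * ((D + 4 * C) ^+ m.+1 - D ^+ m.+1).
  rewrite exprDn big_ord_recl /= subn0 expr0 mulr1 bin0 mulr1n addrC addKr.
  rewrite (big_cat_nat _ (n := m.+1)) //=; last by lia.
  rewrite [X in _ + X]big1_seq ?addr0; last first.
    move=> k /andP[_]; rewrite mem_index_iota => /andP[mk _].
    by rewrite bin_small ?mul0r // ltnS.
  rewrite big_mkord !mulr_sumr; apply: eq_bigr => -[k km] _ /=.
  rewrite /bump /= add1n subSS em -addnBA ?exprD // exprS -mulr_natr; ring.
have e1 : D + 4 * C = B ^+ 2 by rewrite eD; ring.
(* As 2(m+1) = p+1, this is B^p = B, valid also for B = 0. *)
have e2 : (B ^+ 2) ^+ m.+1 = B ^+ 2.
  by rewrite -exprM mul2n doubleS exprS -p_half Fp_expp expr2.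
have e3 : D ^+ m * D ^+ m.+1 = D.
  by rewrite -exprD addnS addnn -p_half Fp_expp.
rewrite mulrDr.
transitivity (- (2 * C) + 4 * C * (\sum_(0 <= k < p.-1) 'C(m.+1, k.+1)%:R * (4 * C) ^+ k * D ^+ (p.-1 - k))).
  by ring.
rewrite sumE e1 e2 mulrBr e3 {2}eD; ring.
Qed.

End ModP.

(** * Congruences between rationals through integer fractions *)

Lemma p_integral_frac p (a e : int) : prime p -> ~~ (p %| e)%Z ->
  p_integral p (a%:~R / e%:~R).
Proof.
move=> p_pr pe; set x := _ / _; rewrite /p_integral /coprimez -[gcdz _ _]/(gcdn _ _)%:Z.
have e0 : e%:~R != 0 :> rat by rewrite intr_eq0; apply: contraNneq pe => ->; rewrite dvdz0.
(* The reduced denominator divides every denominator, by coprimality with the numerator. *)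
suff den : (denq x %| e)%Z.
  rewrite -[_ == _]/(coprime p `|denq x|) prime_coprime //.
  by apply: contra pe => pdn; apply: dvdz_trans den.
have num : numq x * e = a * denq x.
  apply/eqP; rewrite -(eqr_int rat) !rmorphM /=; apply/eqP.
  have := divq_num_den x; have dn : (denq x)%:~R != 0 :> rat by rewrite intr_eq0 denq_eq0.
  move/(canRL (divfK dn)) => ->; rewrite /x mulrAC divfK //.
rewrite -(@Gauss_dvdzr _ (numq x)); first by rewrite num dvdz_mull.
by rewrite coprimez_sym; apply: coprime_num_den.
Qed.

(** Cross-multiplication turns the congruence into an integer divisibility, which can be tested in
    ['F_p]. *)
Lemma eqmod_rat_frac p (a e a' e' : int) : prime p ->
  ~~ (p %| e)%Z -> ~~ (p %| e')%Z -> (p %| a * e' - a' * e)%Z ->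
  eqmod_rat p (a%:~R / e%:~R) (a'%:~R / e'%:~R).
Proof.
move=> p_pr pe pe' /dvdzP[q hq]; split; [exact: p_integral_frac..|].
have nz (y : int) : ~~ (p %| y)%Z -> y%:~R != 0 :> rat.
  by rewrite intr_eq0; apply: contraNneq => ->; rewrite dvdz0.
have e0 := nz _ pe; have e0' := nz _ pe'.
exists (q%:~R / (e * e')%:~R).
  apply: p_integral_frac => //.
  by rewrite -Fp_int_eq0 // intrM mulf_eq0 negb_or !Fp_int_eq0 // pe.
have {}hq : a%:~R * e'%:~R - a'%:~R * e%:~R = q%:~R * p%:R :> rat.
  by rewrite -!intrM -intrB hq intrM pmulrn.
rewrite intrM mulrA [p%:R * _]mulrC -hq; field; by rewrite e0 e0'.
Qed.

(** * The rational Catalan sum and assembly of the theorem *)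

Lemma catalanE k : catalan k = (catz k)%:~R.
Proof.
have k0 : k.+1%:R != 0 :> rat by rewrite pnatr_eq0.
apply: (mulfI k0); rewrite /catalan mulrC divfK //.
by have /(congr1 (fun x : int => x%:~R : rat)) := catzE k; rewrite /= intrM !rmorph_nat => ->.
Qed.

Lemma sum_catalanE (c d : int) n :
  \sum_(0 <= k < n.+1) 'C(n.+1 - 1, k)%:R * 'C(n.+1 + k, k)%:R * catalan k
      * c%:~R ^+ k * d%:~R ^+ (n.+1 - 1 - k) = (hsum c d n (wcoef n))%:~R :> rat.
Proof.
rewrite intr_hsum subn1; apply: eq_bigr => k _; rewrite catalanE /wcoef /scoef.
by rewrite !intrM !rmorph_nat.
Qed.

Theorem theorem1p3 (b c d : int) (hd : d = b ^+ 2 - 4 * c) :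
  (forall n : nat, (0 < n)%N ->
     (\sum_(0 <= k < n)
        (2 * k + 1)%:R * trinom b c k ^+ 2 * (- d) ^+ (n - 1 - k)
      = 0 %[mod n])%Z
     /\ b * (\sum_(0 <= k < n)
               (2 * k + 1)%:R * trinom b c k ^+ 2 * (- d) ^+ (n - 1 - k))
        = n%:R * trinom b c n * trinom b c (n - 1))
  /\
  (forall n : nat, (0 < n)%N ->
     1 / (n%:R : rat) ^+ 2 *
       (\sum_(0 <= k < n)
          (2 * k + 1)%:R * (trinom b c k)%:~R ^+ 2 * d%:~R ^+ (n - 1 - k))
     = \sum_(0 <= k < n)
         'C(n - 1, k)%:R * 'C(n + k, k)%:R * catalan k
           * c%:~R ^+ k * d%:~R ^+ (n - 1 - k)
     /\ \sum_(0 <= k < n)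
         'C(n - 1, k)%:R * 'C(n + k, k)%:R * catalan k
           * c%:~R ^+ k * d%:~R ^+ (n - 1 - k) \is a Num.int)
  /\
  (c <> 0 -> forall p : nat, prime p -> odd p -> ~ (p %| d)%Z ->
     eqmod_rat p
       (1 / (p%:R : rat) ^+ 2 *
          (\sum_(0 <= k < p)
             (2 * k + 1)%:R * ((trinom b c k)%:~R ^+ 2 / d%:~R ^+ k)))
       (1 + b%:~R ^+ 2 / c%:~R * (((legendre d p)%:~R - 1) / 2))).
Proof.
have sumq n : \sum_(0 <= k < n.+1) (2 * k + 1)%:R * (trinom b c k)%:~R ^+ 2 * d%:~R ^+ (n - k)
    = n.+1%:R ^+ 2 * (hsum c d n (wcoef n))%:~R :> rat.
  have /(congr1 (fun x : int => x%:~R : rat)) := sum_trinom_sqr hd n.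
  rewrite /= [in RHS]intrM rmorphXn /= rmorph_nat => <-.
  rewrite rmorph_sum; apply: eq_bigr => k _.
  by rewrite !rmorphM !rmorphXn /= rmorph_nat.
split=> [[//|n] _|]; first rewrite subn1 /= sum_trinom_sqr_opp //.
  split; last by rewrite mulrCA -trinom_mulS // mulrA.
  by apply/eqP; rewrite eqz_mod_dvd subr0 natz dvdz_mulr.
split=> [[//|n] _|c0 p p_pr p_odd /negP pd].
  rewrite sum_catalanE subn1 /= sumq; split; last exact: intr_int.
  by rewrite mulrA div1r mulVf ?mul1r // expf_neq0 // pnatr_eq0.
have dq : d%:~R != 0 :> rat by rewrite intr_eq0; apply: contraNneq pd => ->; rewrite dvdz0.
have p0 := prime_gt0 p_pr; have p2 := prime_gt1 p_pr.
have pq : p%:R != 0 :> rat by rewrite pnatr_eq0 -lt0n.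
(* Over the common denominator d^(p-1), the factor p^2 from [sumq] cancels. *)
have -> : 1 / (p%:R : rat) ^+ 2 * (\sum_(0 <= k < p)
             (2 * k + 1)%:R * ((trinom b c k)%:~R ^+ 2 / d%:~R ^+ k))
   = (hsum c d p.-1 (wcoef p.-1))%:~R / (d ^+ p.-1)%:~R.
  have := sumq p.-1; rewrite prednK // => e.
  rewrite div1r; apply: (mulfI (expf_neq0 2 pq)).
  rewrite mulVKf ?expf_neq0 // mulrA -e.
  rewrite mulr_suml; apply: eq_big_nat => k kp.
  rewrite rmorphXn /= -!mulrA; congr (_ * (_ * _)).
  have -> : p.-1 = (p.-1 - k + k)%N by lia.
  by rewrite addnK exprD; field; rewrite !expf_neq0.
have pdp : ~~ (p %| d ^+ p.-1)%Z.
  by rewrite -Fp_int_eq0 // rmorphXn /= expf_eq0 Fp_int_eq0 // (negPf pd) andbF.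
have dF : d%:~R != 0 :> 'F_p by rewrite Fp_int_eq0.
(* If p divides c, then d is b^2 modulo p and the symbol is 1, so b^2/c, possibly not p-integral, is
   multiplied by 0. *)
have [pc|pc] := boolP (p %| c)%Z.
  have -> : legendre d p = 1.
    have := legendre_euler p_pr p_odd pd.
    have cF : c%:~R = 0 :> 'F_p by apply/eqP; rewrite Fp_int_eq0.
    have dE : d%:~R = b%:~R ^+ 2 :> 'F_p.
      by rewrite hd rmorphB rmorphXn rmorphM /= cF mulr0 subr0.
    have bF : b%:~R != 0 :> 'F_p by apply: contraNneq dF => b0; rewrite dE b0 expr0n.
    rewrite dE exprAC Fp_half_exp //.
    rewrite /legendre (negPf pd); case: ifP => // _ /eqP.
    rewrite rmorphN rmorph1 eq_sym -subr_eq0 opprK -[1 + 1]/(2%:R).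
    by rewrite (negPf (Fp_nat_neq0 p_pr _)) //; move: p_odd p2; case: (p) => [|[|[|]]].
  have -> : 1 + b%:~R ^+ 2 / c%:~R * ((1%:~R - 1) / 2) = 1%:~R / 1%:~R :> rat.
    by rewrite subrr mul0r mulr0 addr0 divr1.
  apply: eqmod_rat_frac => //.
    by rewrite dvdz1 /=; case: (p) p2 => [|[]].
  rewrite -Fp_int_eq0 // mulr1 mul1r intrB Fp_hsum_wcoef_dvd // rmorphXn /=.
  by rewrite Fp_fermat // subrr.
have cq : c%:~R != 0 :> rat by rewrite intr_eq0; apply/eqP.
(* Over the denominator 2c, prime to p, the cross-multiplied congruence is [Fp_hsum_wcoef], as
   d^(p-1) = 1. *)
have -> : 1 + b%:~R ^+ 2 / c%:~R * (((legendre d p)%:~R - 1) / 2)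
   = (2 * c + b ^+ 2 * (legendre d p - 1))%:~R / (2 * c)%:~R :> rat.
  rewrite intrD (intrM _ 2) (intrM _ (b ^+ 2)) intrB rmorphXn /= rmorph_nat.
  by field; exact: cq.
apply: eqmod_rat_frac => //.
  rewrite -Fp_int_eq0 // intrM mulf_eq0 negb_or !Fp_int_eq0 // pc andbT.
  by rewrite -[(p %| 2)%Z]/(p %| 2)%N gtnNdvd //; move: p_odd p2; case: (p) => [|[|[|]]].
rewrite -Fp_int_eq0 // intrB (intrM _ (2 * _ + _)) (rmorphXn _ _ d) /= Fp_fermat //.
rewrite mulr1 mulrC intrM (intrM _ 2) (Fp_hsum_wcoef p_pr p_odd hd pd pc).
by rewrite intrD (intrM _ 2) (intrM _ (b ^+ 2)) intrB rmorphXn /= rmorph_nat subrr.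
Qed.
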